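(* Let $x>0$ be a real number with ceiling continued fraction expansion $x=\lceil c_0,c_1,c_2,\dots\rceil$, and let $p_0,p_1,p_2,\dots$ be the numerators of its convergents. Then $$\frac{1}{x}=\frac{1}{p_0}+\frac{1}{p_0p_1}+\frac{1}{p_1p_2}+\frac{1}{p_2p_3}+\cdots,$$ where, if the expansion is finite with last coefficient $c_n$, the sum ends with the term $\frac{1}{p_{n-1}p_n}$.
   Context: The ceiling continued fraction (FCT) expansion of a real number $x$ is obtained by the Euclidean algorithm with the ceiling function: set $x_0=x$, $c_0=\lceil x_0\rceil$, and while $x_j\neq c_j$ put $x_{j+1}=1/(c_j-x_j)$ and $c_{j+1}=\lceil x_{j+1}\rceil$; the procedure stops at the first $j$ with $x_j=c_j$. This gives $x=c_0-\cfrac{1}{c_1-\cfrac{1}{c_2-\cdots}}$, written $x=\lceil c_0,c_1,c_2,\dots\rceil$. The convergent numerators and denominators are defined by the negative recurrence $p_j=c_jp_{j-1}-p_{j-2}$, $q_j=c_jq_{j-1}-q_{j-2}$ with $(p_{-1},q_{-1})=(1,0)$ and $(p_{-2},q_{-2})=(0,-1)$, so that $p_0=c_0$, $q_0=1$. *)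

(* Defs.v *)
From mathcomp Require Import all_boot all_order all_algebra.
From mathcomp Require Import all_classical all_reals all_analysis.

Set Implicit Arguments.
Unset Strict Implicit.
Unset Printing Implicit Defensive.

Import Order.TTheory GRing.Theory Num.Theory.
Local Open Scope ring_scope.

(* The complete quotient x_j; it is None once the algorithm has stopped at an
   earlier step. *)
Fixpoint fct_quot (R : realType) (x : R) (j : nat) : option R :=
  if j is i.+1 then
    if fct_quot x i is Some y then
      if y == (Num.ceil y)%:~R then None else Some (1 / ((Num.ceil y)%:~R - y))
    else None
  else Some x.

Definition fct_coef (R : realType) (x : R) (j : nat) : option int :=
  omap Num.ceil (fct_quot x j).

Definition fct_infinite (R : realType) (x : R) : Prop :=
  forall j, fct_coef x j <> None.

Definition fct_last (R : realType) (x : R) (n : nat) : Prop :=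
  fct_coef x n <> None /\ fct_coef x n.+1 = None.

(* Indices are shifted by two: negrec c a b k is u_(k-2) for the sequence with
   u_(-2) = a, u_(-1) = b and u_j = c_j u_(j-1) - u_(j-2). *)
Fixpoint negrec (c : nat -> int) (a b : int) (k : nat) : int :=
  match k with
  | 0%N => a
  | k1.+1 => match k1 with
             | 0%N => b
             | j.+1 => c j * negrec c a b k1 - negrec c a b j
             end
  end.

(* The numerator p_j. The default coefficient 0 is only used for indices j
   beyond the end of a finite expansion, where p_j is meaningless. *)
Definition fct_num (R : realType) (x : R) (j : nat) : int :=
  negrec (fun i => odflt 0 (fct_coef x i)) 0 1 j.+2.

(* Main.v *)
(* Write r_n = c_n - x_n in [0, 1). By induction 1/x equals the sum up to
   1/(p_(n-1) p_n) plus the remainder r_n / (p_n (p_n - r_n p_(n-1))), where p is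
   nondecreasing, p >= 1, and p_n - r_n p_(n-1) >= x. If the expansion stops at
   n then r_n = 0. Otherwise the partial sums stay below 1/x, which forces p to
   be unbounded, and the remainder is at most 1/(p_n x), hence tends to 0. *)
Require Import Defs.
From mathcomp Require Import all_boot all_order all_algebra.
From mathcomp Require Import all_classical all_reals all_analysis.
From mathcomp Require Import ring lra.

Set Implicit Arguments.
Unset Strict Implicit.
Unset Printing Implicit Defensive.

Import Order.TTheory GRing.Theory Num.Theory.
Import numFieldNormedType.Exports.
Local Open Scope classical_set_scope.
Local Open Scope ring_scope.

Lemma fct_num0 (R : realType) (x : R) : fct_num x 0 = Num.ceil x.
Proof. by rewrite /fct_num /fct_coef /= mulr1 subr0. Qed.

(* [negrec _ 0 1 n.+1] is p_(n-1), including p_(-1) = 1. *)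
Lemma fct_numS (R : realType) (x : R) (n : nat) (y : R) :
  fct_quot x n.+1 = Some y ->
  fct_num x n.+1 = Num.ceil y * fct_num x n
    - negrec (fun i => odflt 0 (fct_coef x i)) 0 1 n.+1.
Proof. by move=> Hy; rewrite {1}/fct_num [LHS]/= {1}/fct_coef Hy. Qed.

Lemma fct_quotS_inv (R : realType) (x : R) (n : nat) (z : R) :
  fct_quot x n.+1 = Some z ->
  exists y, [/\ fct_quot x n = Some y, y != (Num.ceil y)%:~R
              & z = 1 / ((Num.ceil y)%:~R - y)].
Proof.
move=> /=; case: (fct_quot x n) => // y; case: ifPn => // yc [<-].
by exists y.
Qed.

Lemma fct_quot_le (R : realType) (x : R) (m n : nat) :
  (m <= n)%N -> fct_quot x n <> None -> fct_quot x m <> None.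
Proof.
move=> /subnK <-; elim: (n - m)%N => [//|k IH]; rewrite addSn => H.
apply: IH => E; apply: H; by rewrite /= E.
Qed.

(* With r = c_n - x_n, the quantity p_n - r p_(n-1) gets divided by r at each
   step; it starts at x, so it never drops below x. *)
Lemma fct_remainder (R : realType) (x : R) (n : nat) (y : R) :
  0 < x -> fct_quot x n = Some y ->
  let p (j : nat) : R := (fct_num x j)%:~R in
  let pp : R := (negrec (fun i => odflt 0 (fct_coef x i)) 0 1 n.+1)%:~R in
  let r : R := (Num.ceil y)%:~R - y in
  [/\ 1 <= pp, pp <= p n, x <= p n - r * pp &
      1 / x = 1 / p 0%N + \sum_(0 <= j < n) 1 / (p j * p j.+1)
              + r / (p n * (p n - r * pp))].
Proof.
move=> x0; elim: n y => [|n IH] y.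
  move=> [<-] p pp r.
  have c0 : (1 <= (Num.ceil x)%:~R :> R).
    by rewrite ler1z -gtz0_ge1 -ceil_gt0 in x0 *.
  rewrite /p /pp /r fct_num0 /= big_geq // addr0; split=> //; first by lra.
  by field; do ?[apply/andP; split]; lra.
move=> Hz p pp r.
have [w [Hw wc yE]] := fct_quotS_inv Hz.
have := IH _ Hw; rewrite -/p /=.
(* Here [w] is x_n and [y] is x_(n+1); [q] is p_(n-1) and [s] is r_n, so that [y] = 1 / [s]. *)
set qq := (X in X%:~R); set q : R := qq%:~R; set s := _ - w in yE *.
move=> [q1 qp xP xE].
have s0 : 0 < s by rewrite subr_gt0 lt_neqAle wc ceil_ge.
have s1 : s < 1 by have := ceilB1_lt w; rewrite /s intrD; lra.
have y1 : 1 < y by rewrite yE div1r invf_gt1.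
(* Every coefficient after c_0 is at least 2, because its complete quotient exceeds 1. Together with
   p_(n-1) <= p_n this gives p_(n+1) >= 2 p_n - p_(n-1) >= p_n. *)
have c2 : (2 <= (Num.ceil y)%:~R :> R).
  have : (1 < (Num.ceil y)%:~R :> R) by apply: lt_le_trans y1 (ceil_ge _).
  by rewrite ltr1z -lez1D (ler_int _ 2).
have pS : p n.+1 = (Num.ceil y)%:~R * p n - q.
  by rewrite /p (fct_numS Hz) intrB intrM.
have ppE : pp = p n by [].
(* The left side is [y] p_n - p_(n-1), since subtracting [r] p_n replaces c_(n+1) by x_(n+1).
   Dividing by [s] < 1 keeps it at least [x]. *)
have PS : p n.+1 - r * pp = (p n - s * q) / s.
  by rewrite pS ppE /r; set c := _%:~R; rewrite yE; field; lra.
have pmono : p n <= p n.+1 by rewrite pS; nra.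
rewrite PS; split; rewrite ?ppE //; first by lra.
  by rewrite ler_pdivlMr //; nra.
rewrite big_nat_recr //= xE -!addrA; congr (_ + (_ + _)).
(* Eliminating c_(n+1) from [r] makes the new remainder split, by partial fractions, into the old
   remainder minus 1 / (p_n p_(n+1)). *)
have -> : r = (p n.+1 * s - (p n - s * q)) / (s * p n).
  by rewrite pS /r; set c := _%:~R; rewrite yE; field; do ?[apply/andP; split]; lra.
by field; rewrite /q; do ?[apply/andP; split]; lra.
Qed.

Theorem theorem2p1 (R : realType) (x : R) (hx : 0 < x) :
  let p (j : nat) : R := (fct_num x j)%:~R in
  (forall n : nat, fct_last x n ->
     (forall j : nat, (j <= n)%N -> p j != 0) /\
     1 / x = 1 / p 0%N + \sum_(0 <= j < n) 1 / (p j * p j.+1)) /\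
  (fct_infinite x ->
     (forall j : nat, p j != 0) /\
     (fun n : nat => 1 / p 0%N + \sum_(0 <= j < n) 1 / (p j * p j.+1))
       @ \oo --> 1 / x).
Proof.
set p := fun j : nat => _ : R => /=.
have quot_coef j : fct_coef x j <> None -> fct_quot x j <> None.
  by rewrite /fct_coef; case: fct_quot.
have p_ge1 j : fct_quot x j <> None -> 1 <= p j.
  case E : (fct_quot x j) => [y|] // _.
  by have [h1 h2 _ _] := fct_remainder hx E; apply: le_trans h1 h2.
split=> [n [Hn HSn]|Hinf].
  have qn := quot_coef _ Hn; split=> [j jn|].
    by have := p_ge1 _ (fct_quot_le jn qn) => h; rewrite gt_eqF //; lra.
  case E : (fct_quot x n) qn => [y|] // _.
  have [_ _ _ ->] := fct_remainder hx E.
  (* Stopping after step n means x_n = c_n, so the remainder has numerator 0. *)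
  move: HSn; rewrite /fct_coef /= E; case: eqP => //= yc _.
  by rewrite -yc subrr mul0r addr0.
have Q j : fct_quot x j <> None := quot_coef _ (Hinf j).
have p1 j : 1 <= p j := p_ge1 _ (Q j).
split=> [j|]; first by rewrite gt_eqF //; have := p1 j; lra.
set S := fun n : nat => _ : R.
have pmono : {homo p : m n / (m <= n)%N >-> m <= n}.
  apply: homo_leq => // [|n]; first exact: le_trans.
  case E : (fct_quot x n.+1) (Q n.+1) => [y|] // _.
  by have [_ h _ _] := fct_remainder hx E.
have rem n : 0 <= 1 / x - S n <= (p n * x)^-1.
  case E : (fct_quot x n) (Q n) => [y|] // _.
  have [q1 qp xP ->] := fct_remainder hx E.
  (* The partial sum cancels and only the remainder is left; it is bounded using r_n <= 1 and p_n -
     r_n p_(n-1) >= x. *)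
  rewrite -/p -/(S n) [_ + _ - _]addrC addKr.
  have r0 : 0 <= (Num.ceil y)%:~R - y by rewrite subr_ge0 ceil_ge.
  have r1 : (Num.ceil y)%:~R - y <= 1 by have := ceilB1_lt y; rewrite intrD; lra.
  have pn0 : 0 < p n by have := p1 n; lra.
  have P0 := lt_le_trans hx xP.
  have pP0 := mulr_gt0 pn0 P0.
  rewrite divr_ge0 ?(ltW pP0) //= -[leRHS]mul1r.
  apply: ler_pM => //; first by rewrite invr_ge0 ltW.
  by rewrite lef_pV2 ?posrE ?mulr_gt0 // ler_pM2l.
(* If p were bounded by K, the partial sums would grow like n / K ^ 2. *)
have punb (K : R) : exists N, K < p N.
  apply: contrapT => /forallNP H.
  have pK j : p j <= K by rewrite leNgt; apply/negP/H.
  have K0 : 0 < K by have := p1 0%N; have := pK 0%N; lra.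
  have SK n : n%:R / K ^+ 2 <= S n.
    rewrite /S -[leLHS]add0r lerD ?divr_ge0 //; first by have := p1 0%N; lra.
    rewrite mulr_natl -[n in leLHS]subn0 -sumr_const_nat ler_sum // => j _.
    rewrite div1r lef_pV2 ?posrE ?exprn_gt0 ?mulr_gt0 //.
    - by rewrite expr2 ler_pM //; [have := p1 j|have := p1 j.+1]; lra.
    - by have := p1 j; lra.
    - by have := p1 j.+1; lra.
  (* An integer n > K ^ 2 / x contradicts n / K ^ 2 <= S n <= 1 / x. *)
  have /archi_boundP : 0 <= K ^+ 2 / x by rewrite divr_ge0 ?exprn_ge0 ?ltW.
  set n := Num.bound _; apply/negP; rewrite -leNgt.
  have /andP[h _] := rem n.
  have : n%:R / K ^+ 2 <= 1 / x by have := SK n; lra.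
  by rewrite ler_pdivrMr ?exprn_gt0 // mulrC mul1r.
apply/cvgrPdist_le => e e0.
(* Once p_n >= 1 / (e x), the remainder bound 1 / (p_n x) is at most e; monotonicity of p extends
   this to all n >= N. *)
have [N HN] := punb (e * x)^-1.
near=> n.
have /andP[h0 h1] := rem n.
rewrite ger0_norm //; apply: le_trans h1 _.
have ex0 : 0 < e * x by rewrite mulr_gt0.
have pn : (e * x)^-1 <= p n.
  by apply: le_trans (ltW HN) (pmono _ _ _); near: n; exists N.
have pn0 : 0 < p n by have := p1 n; lra.
rewrite -[leRHS]invrK lef_pV2 ?posrE ?invr_gt0 ?mulr_gt0 //.
by rewrite -ler_pdivrMr // -invfM.
Unshelve. all: by end_near.
Qed.
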